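(* Let $\Gamma$ be a metrized graph with $v \geq 5$ vertices and let $k$ be an integer with $1 \leq k \leq v-4$. Then $$Kf(\Gamma)= \frac{(v-4-k)!}{(v-4)!}\sum_{e_{i_1} \in E(\Gamma)}\frac{R_{i_1}}{L_{i_1}+R_{i_1}} \sum_{e_{i_2} \in E(\overline{\Gamma}_{i_1})}\frac{R_{i_2}}{L_{i_2}+R_{i_2}}\cdots\sum_{e_{i_k} \in E(\overline{\Gamma}_{i_1, \dots, i_{k-1}})}\frac{R_{i_k}}{L_{i_k}+R_{i_k}}\, Kf(\overline{\Gamma}_{i_1,\dots, i_k}) -\frac{\big(v^2-(k+2)v+k-1 \big)k}{(v-k-2)(v-k-3) }\,y(\Gamma),$$ where the sums are over admissible contractions. In particular, for $k=v-4$, $$Kf(\Gamma)= \frac{1}{(v-4)!}\sum_{e_{i_1} \in E(\Gamma)}\frac{R_{i_1}}{L_{i_1}+R_{i_1}} \cdots\sum_{e_{i_{v-4}} \in E(\overline{\Gamma}_{i_1, \dots, i_{v-5}})}\frac{R_{i_{v-4}}}{L_{i_{v-4}}+R_{i_{v-4}}}\, Kf(\overline{\Gamma}_{i_1,\dots, i_{v-4}}) -\frac{(3v-5)(v-4)}{2}\,y(\Gamma).$$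
   Context: A metrized graph $\Gamma$ is a finite connected graph (multiple edges and self-loops allowed) each of whose edges is identified with a closed segment of positive length. Its vertex set $V(\Gamma)$ is a finite nonempty set containing every point of valence $\neq 2$; $v=\#V(\Gamma)$; $E(\Gamma)$ is its edge set, $L_i$ the length of $e_i$. $r(x,y)$ is the effective resistance (edges as resistors of resistance equal to length). For an edge $e_i$ with end points $p_i,q_i$: if $\Gamma-e_i$ (interior of $e_i$ deleted) is connected, $R_i$ is the effective resistance between $p_i,q_i$ in $\Gamma-e_i$, and $R_{a_i,p}=\hat j_{p_i}(p,q_i)$, $R_{b_i,p}=\hat j_{q_i}(p,p_i)$ with $\hat j_z(x,y)$ the voltage function of $\Gamma-e_i$ (potential at $x$ when unit current enters at $y$, exits at $z$, potential $0$ at $z$), so $R_{a_i,p}+R_{b_i,p}=R_i$; if $e_i$ is a bridge, $R_{a_i,p}=0,R_{b_i,p}=R_i$ for $p$ in the component of $\Gamma-e_i$ containing $p_i$ and $R_{a_i,p}=R_i,R_{b_i,p}=0$ otherwise, and every expression involving $R_i$ is interpreted as its limit as $R_i\to\infty$; for a self-loop $R_i=0$. $Kf(\Gamma)=\frac12\sum_{p,q\in V(\Gamma)}r(p,q)$. $\overline{\Gamma}_i$ is obtained by contracting $e_i$ to a point (vertex set the image of $V(\Gamma)$); $\overline{\Gamma}_{i_1,\dots,i_k}$ is obtained by successively contracting $e_{i_1}\in E(\Gamma)$, then $e_{i_2}\in E(\overline\Gamma_{i_1})$, etc.; the quantities $L_{i_j},R_{i_j}$ are computed in the graph $\overline{\Gamma}_{i_1,\dots,i_{j-1}}$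 in which $e_{i_j}$ is contracted. The contraction is admissible if at each step the contracted edge has distinct end points (is not a self-loop); self-loop terms vanish anyway since $R=0$. For a fixed vertex $p$ (the value is independent of $p$), $y(\Gamma)=\frac14\sum_{e_i}\frac{L_iR_i^2}{(L_i+R_i)^2}+\frac34\sum_{e_i}\frac{L_i(R_{a_i,p}-R_{b_i,p})^2}{(L_i+R_i)^2}$. *)

(* Defs.v *)
(* Metrized graphs in their combinatorial model:
   vertices are natural-number labels, edges a list of triples
   (p, q, L) = (end point, end point, length). Multiple edges and
   self-loops are allowed; edges are identified by their index in the list. *)
From HB Require Import structures.
From mathcomp Require Import all_boot all_order all_algebra.
From Stdlib Require Import ClassicalEpsilon Relation_Operators.

Set Implicit Arguments.
Unset Strict Implicit.
Unset Printing Implicit Defensive.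

Import Order.TTheory GRing.Theory Num.Theory.
Local Open Scope ring_scope.

Section MetrizedGraphs.
Variable R : realFieldType.

Record mgraph := MGraph { verts : seq nat; edges : seq (nat * nat * R) }.

Definition adj (G : mgraph) (x y : nat) : bool :=
  has (fun e => ((e.1.1 == x) && (e.1.2 == y)) || ((e.1.1 == y) && (e.1.2 == x)))
      (edges G).

Definition connected (G : mgraph) : Prop :=
  forall x y, x \in verts G -> y \in verts G ->
    clos_refl_trans nat (fun a b => adj G a b) x y.

Definition is_mgraph (G : mgraph) : Prop :=
  [/\ uniq (verts G), verts G != [::],
      all (fun e => [&& e.1.1 \in verts G, e.1.2 \in verts G & 0 < e.2]) (edges G)
    & connected G].

(* net current leaving vertex x for the potential f (conductance 1/L) *)
Definition net_out (G : mgraph) (f : nat -> R) (x : nat) : R :=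
  \sum_(e <- edges G)
     ((e.1.1 == x)%:R * (f e.1.1 - f e.1.2) / e.2
    + (e.1.2 == x)%:R * (f e.1.2 - f e.1.1) / e.2).

(* f is the potential when unit current enters at y and exits at z,
   with potential 0 at z (Kirchhoff's laws) *)
Definition is_potential (G : mgraph) (y z : nat) (f : nat -> R) : Prop :=
  f z = 0 /\
  forall x, x \in verts G -> net_out G f x = (x == y)%:R - (x == z)%:R.

Definition voltage (G : mgraph) (z x y : nat) : R :=
  epsilon (inhabits (fun _ : nat => (0 : R))) (is_potential G y z) x.

Definition resist (G : mgraph) (x y : nat) : R := voltage G y x x.

Definition Kf (G : mgraph) : R :=
  2^-1 * \sum_(p <- verts G) \sum_(q <- verts G) resist G p q.

Definition edge (G : mgraph) (i : nat) : nat * nat * R :=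
  nth (0%N, 0%N, 0) (edges G) i.

Definition delete (G : mgraph) (i : nat) : mgraph :=
  MGraph (verts G) (take i (edges G) ++ drop i.+1 (edges G)).

Definition is_bridge (G : mgraph) (i : nat) : Prop := ~ connected (delete G i).

Definition nonloop (G : mgraph) (i : nat) : bool :=
  (edge G i).1.1 != (edge G i).1.2.

Definition Ri (G : mgraph) (i : nat) : R :=
  resist (delete G i) (edge G i).1.1 (edge G i).1.2.

(* R_i / (L_i + R_i), with the bridge convention (limit R_i -> oo, i.e. 1) *)
Definition coef (G : mgraph) (i : nat) : R :=
  if excluded_middle_informative (is_bridge G i) then 1
  else Ri G i / ((edge G i).2 + Ri G i).

Definition contract (G : mgraph) (i : nat) : mgraph :=
  let a := (edge G i).1.1 in let b := (edge G i).1.2 in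
  let ren x := if x == b then a else x in
  MGraph (undup (map ren (verts G)))
         (map (fun e => (ren e.1.1, ren e.1.2, e.2)) (edges (delete G i))).

Fixpoint iter_sum (k : nat) (G : mgraph) : R :=
  match k with
  | 0%N => Kf G
  | k'.+1 => \sum_(i < size (edges G) | nonloop G i)
               coef G i * iter_sum k' (contract G i)
  end.

(* contribution of e_i to y(Gamma) for the base vertex p.  For a bridge the
   limit R_i -> oo of the two summands is L_i/4 + 3 L_i/4. *)
Definition yterm (G : mgraph) (p : nat) (i : nat) : R :=
  let a := (edge G i).1.1 in let b := (edge G i).1.2 in let L := (edge G i).2 in
  if excluded_middle_informative (is_bridge G i) then 4^-1 * L + 3 / 4 * L
  else
    let D := delete G i in
    let Rr := Ri G i in
    let Ra := voltage D a p b in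
    let Rb := voltage D b p a in
    4^-1 * (L * Rr ^+ 2 / (L + Rr) ^+ 2)
    + 3 / 4 * (L * (Ra - Rb) ^+ 2 / (L + Rr) ^+ 2).

Definition yinv (G : mgraph) (p : nat) : R :=
  \sum_(i < size (edges G)) yterm G p i.

End MetrizedGraphs.

(* Main.v *)
(* Fix a base vertex p and let g be the Green kernel of the graph: g y is the
   potential vanishing at p when unit current enters at y and exits at p.
   Everything is a rational expression in g.  With f_e = g_a - g_b for an edge
   e = (a, b, L) and r_e = f_e(a) - f_e(b) the effective resistance across e:
     R_e / (L + R_e) = r_e / L,
     the e-term of y is (f_e(a)^2 + f_e(a) f_e(b) + f_e(b)^2) / L,
   bridges included, and contracting e turns g(x,y) into
   g(x,y) - f_e(x) f_e(y) / r_e.  Summing over e with Foster's identity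
   (sum of r_e / L = v - 1) and Green's identities yields
     sum_e r_e/L Kf(G/e) = (v - 4) Kf(G) + v y(G),
     sum_e r_e/L y(G/e) = (v - 2) y(G);
   the terms of fourth degree in the second identity collapse because
   (s - t)^2 (s^2 + s t + t^2) = (s - t) (s^3 - t^3).  Induction on k concludes. *)
Require Import Defs.
From HB Require Import structures.
From mathcomp Require Import all_boot all_order all_algebra.
From mathcomp Require Import ring zify.
From Stdlib Require Import Classical ClassicalEpsilon Relation_Operators.
Import Order.TTheory GRing.Theory Num.Theory.
Local Open Scope ring_scope.

Section Networks.
Context {R : realFieldType}.
Implicit Types (G : mgraph R) (f h : nat -> R) (g : nat -> nat -> R).

(** * Net currents, the Dirichlet form, and existence and uniqueness of potentials *)

Lemma net_out_ext G f h x : f =1 h -> net_out G f x = net_out G h x.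
Proof. by move=> fh; apply: eq_bigr => e _; rewrite !fh. Qed.

Lemma net_out_lin G c f h x :
  net_out G (fun y => c * f y + h y) x = c * net_out G f x + net_out G h x.
Proof.
rewrite /net_out mulr_sumr -big_split; apply: eq_bigr => e _ /=; ring.
Qed.

Lemma net_outB G f h x :
  net_out G (fun y => f y - h y) x = net_out G f x - net_out G h x.
Proof.
rewrite /net_out -sumrB; apply: eq_bigr => e _ /=; ring.
Qed.

Lemma net_out_sum G (I : Type) (r : seq I) (c : I -> R) (h : I -> nat -> R) x :
  net_out G (fun y => \sum_(i <- r) c i * h i y) x =
  \sum_(i <- r) c i * net_out G (h i) x.
Proof.
elim: r => [|i r IHr].
  rewrite big_nil /net_out big1 // => e _; rewrite !big_nil; ring.
rewrite big_cons -IHr -net_out_lin.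
by apply: net_out_ext => y; rewrite big_cons.
Qed.

Lemma edge_ends G e : is_mgraph G -> e \in edges G ->
  [/\ e.1.1 \in verts G, e.1.2 \in verts G & 0 < e.2].
Proof. by case=> _ _ /allP H _ /H /and3P[]. Qed.

Lemma sum_delta (V : seq nat) (a : nat) (F : nat -> R) : uniq V -> a \in V ->
  \sum_(x <- V) (a == x)%:R * F x = F a.
Proof.
move=> uV aV; rewrite (bigD1_seq a) //= eqxx mul1r big1 ?addr0 // => x.
by rewrite eq_sym => /negPf ->; rewrite mul0r.
Qed.

(** Each edge contributes only at its two ends. The potential [g x] may vary with the vertex [x]
    where its net current is read; Foster's identity and the star sums need this, since there the
    source sits at that vertex. *)
Lemma sum_net_out G F g : is_mgraph G ->
  \sum_(x <- verts G) F x * net_out G (g x) x =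
  \sum_(e <- edges G) (F e.1.1 * (g e.1.1 e.1.1 - g e.1.1 e.1.2)
                       + F e.1.2 * (g e.1.2 e.1.2 - g e.1.2 e.1.1)) / e.2.
Proof.
move=> mG; have [uV _ _ _] := mG.
under eq_bigr do rewrite mulr_sumr.
rewrite exchange_big big_seq [RHS]big_seq; apply: eq_bigr => e /(edge_ends _ _ mG)[aV bV _].
rewrite -(sum_delta _ _ (fun x => F x * (g x e.1.1 - g x e.1.2)) uV aV).
rewrite -(sum_delta _ _ (fun x => F x * (g x e.1.2 - g x e.1.1)) uV bV).
rewrite -big_split mulr_suml; apply: eq_bigr => x _ /=; ring.
Qed.

Definition dirichlet G f h :=
  \sum_(e <- edges G) (f e.1.1 - f e.1.2) * (h e.1.1 - h e.1.2) / e.2.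

Lemma sum_net_out_dirichlet G f h : is_mgraph G ->
  \sum_(x <- verts G) f x * net_out G h x = dirichlet G f h.
Proof.
move=> mG; rewrite (sum_net_out _ _ (fun=> h)) //.
by apply: eq_bigr => e _; congr (_ / _); ring.
Qed.

Lemma dirichlet_ge0 G h : is_mgraph G -> 0 <= dirichlet G h h.
Proof.
move=> mG; rewrite /dirichlet big_seq sumr_ge0 // => e /(edge_ends _ _ mG)[_ _ L0].
by rewrite -expr2 divr_ge0 ?sqr_ge0 // ltW.
Qed.

(** This is [is_potential] without the normalisation at [z], so that potentials normalised
    elsewhere, or nowhere, can be compared. *)
Definition dipole G y z h := forall x, x \in verts G ->
  net_out G h x = (x == y)%:R - (x == z)%:R.

(** Reproducing property: summation by parts turns the energy pairing into [f] evaluated against the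
    charges +1 at [y] and -1 at [z]. *)
Lemma dirichlet_dipole G y z f h : is_mgraph G ->
  y \in verts G -> z \in verts G -> dipole G y z h -> dirichlet G f h = f y - f z.
Proof.
move=> mG yV zV dh; rewrite -sum_net_out_dirichlet // big_seq.
have [uV _ _ _] := mG.
rewrite -(sum_delta _ _ f uV yV) -(sum_delta _ _ f uV zV) -sumrB [RHS]big_seq.
by apply: eq_bigr => x /dh ->; rewrite mulrC mulrBl ![x == _]eq_sym.
Qed.

Lemma eq_on_connected G h : connected G ->
  (forall e, e \in edges G -> h e.1.1 = h e.1.2) ->
  forall x y, x \in verts G -> y \in verts G -> h x = h y.
Proof.
move=> cG He x y xV yV; elim: (cG x y xV yV) => // [a b|a b c _ -> _ -> //].
by case/hasP=> e /He hab /orP[] /andP[/eqP <- /eqP <-].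
Qed.

(** The energy is a sum of nonnegative edge terms, so each potential drop vanishes, and
    connectedness spreads the equality. *)
Lemma dirichlet0_const G h : is_mgraph G -> dirichlet G h h = 0 ->
  forall x y, x \in verts G -> y \in verts G -> h x = h y.
Proof.
move=> mG /eqP; rewrite /dirichlet big_seq psumr_eq0; last first.
  by move=> e /(edge_ends _ _ mG)[_ _ L0]; rewrite -expr2 divr_ge0 ?sqr_ge0 // ltW.
move=> /allP H0; apply: eq_on_connected; first by case: mG.
move=> e eG; have [_ _ L0] := edge_ends _ _ mG eG.
move: (H0 e eG) => /implyP /(_ eG).
by rewrite mulf_eq0 invr_eq0 (gt_eqF L0) orbF mulf_eq0 orbb subr_eq0 => /eqP.
Qed.

(** The difference of the two potentials has no net current at any vertex, hence zero energy. *)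
Lemma dipole_unique G y z f h : is_mgraph G -> dipole G y z f -> dipole G y z h ->
  forall x x', x \in verts G -> x' \in verts G -> f x - f x' = h x - h x'.
Proof.
move=> mG df dh x x' xV x'V.
have D0 : dirichlet G (fun y => f y - h y) (fun y => f y - h y) = 0.
  rewrite -sum_net_out_dirichlet // big_seq big1 // => u uV.
  by rewrite net_outB df // dh // subrr mulr0.
have /= E := dirichlet0_const _ _ mG D0 x x' xV x'V.
by apply/eqP; rewrite -subr_eq0; apply/eqP; rewrite -(subrr (f x - h x)) [in X in _ = _ - X]E; ring.
Qed.

(* The Laplacian plus the rank-one projection on z is injective, hence
   bijective; summing over all vertices shows that the solution vanishes at z. *)
Lemma potential_exists G y z : is_mgraph G -> y \in verts G -> z \in verts G ->
  exists h, is_potential G y z h.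
Proof.
move=> mG yV zV; have [uV _ _ _] := mG.
pose n := size (verts G); pose s (i : 'I_n) := nth 0%N (verts G) i.
have sV i : s i \in verts G by rewrite mem_nth.
pose F (u : 'rV[R]_n) x := \sum_(i < n) u 0 i * (x == s i)%:R.
pose T h x := net_out G h x + (x == z)%:R * h z.
pose M : 'M[R]_n := \matrix_(i, j) T (fun x => (x == s i)%:R) (s j).
have ME (u : 'rV_n) j : (u *m M) 0 j = T (F u) (s j).
  rewrite mxE /T /F net_out_sum mulr_sumr -big_split; apply: eq_bigr => i _ /=.
  by rewrite mxE /T; ring.
have sE x : x \in verts G -> exists i, x = s i.
  move=> xV; have lt : (index x (verts G) < n)%N by rewrite index_mem.
  by exists (Ordinal lt); rewrite /s nth_index.
have FsE u i : F u (s i) = u 0 i.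
  rewrite /F (bigD1 i) //= eqxx mulr1 big1 ?addr0 // => k ki.
  by rewrite /s nth_uniq // val_eqE eq_sym (negPf ki) mulr0.
have Tsum h h' : \sum_(x <- verts G) h' x * T h x = dirichlet G h' h + h z * h' z.
  rewrite /T; under eq_bigr do rewrite mulrDr; rewrite big_split /= sum_net_out_dirichlet //.
  congr (_ + _); rewrite -(sum_delta _ _ (fun x => h z * h' x) uV zV).
  by apply: eq_bigr => x _; rewrite [x == z]eq_sym; ring.
have free : row_free M.
  apply: inj_row_free => u uM0.
  have T0 x : x \in verts G -> T (F u) x = 0.
    by case/sE=> i ->; rewrite -ME uM0 mxE.
  have := Tsum (F u) (F u); rewrite big_seq big1 => [/esym/eqP|x xV]; last by rewrite T0 ?mulr0.
  rewrite paddr_eq0 ?dirichlet_ge0 -?expr2 ?sqr_ge0 // sqrf_eq0 => /andP[/eqP Du /eqP Fz].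
  apply/rowP => i; rewrite mxE -FsE -Fz.
  exact: (dirichlet0_const _ _ mG Du).
have uM : M \in unitmx by rewrite -row_free_unit.
pose t : 'rV[R]_n := \row_j ((s j == y)%:R - (s j == z)%:R).
exists (F (t *m invmx M)); set h := F _.
have Th x : x \in verts G -> T h x = (x == y)%:R - (x == z)%:R.
  by case/sE => j ->; rewrite -ME mulmxKV // mxE.
have hz : h z = 0.
  have := Tsum h (fun=> 1); rewrite /dirichlet [X in _ = X + _]big1 => [|e _];
    last by rewrite subrr !mul0r.
  rewrite add0r mulr1 => <-; rewrite big_seq.
  under eq_bigr => x xV do rewrite mul1r Th //.
  rewrite -big_seq sumrB.
  have S a : a \in verts G -> \sum_(x <- verts G) (x == a)%:R = 1 :> R.
    move=> aV; rewrite -[RHS](sum_delta _ _ (fun=> 1) uV aV).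
    by apply: eq_bigr => x _; rewrite mulr1 eq_sym.
  by rewrite !S // subrr.
split=> // x /Th; by rewrite /T hz mulr0 addr0.
Qed.

(** [voltage] is an [epsilon] choice; existence makes it a true potential, and uniqueness up to a
    constant lets any dipole compute it. *)
Lemma voltage_dipole G y z h x : is_mgraph G ->
  y \in verts G -> z \in verts G -> x \in verts G ->
  dipole G y z h -> voltage G z x y = h x - h z.
Proof.
move=> mG yV zV xV dh.
have := epsilon_spec (inhabits (fun _ : nat => (0 : R))) _ (potential_exists _ _ _ mG yV zV).
rewrite -/(is_potential _ _ _) => -[hz de].
by rewrite -(dipole_unique _ _ _ _ _ mG de dh) // hz subr0.
Qed.

(** * The Green kernel, reciprocity and effective resistance *)

Definition green G p g :=
  forall y, y \in verts G -> is_potential G y p (g y).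

Lemma green_exists G p : is_mgraph G -> p \in verts G -> exists g, green G p g.
Proof.
move=> mG pV; exists (fun y x => voltage G p x y) => y yV.
exact: (epsilon_spec (inhabits (fun _ : nat => (0 : R))) _ (potential_exists _ _ _ mG yV pV)).
Qed.

Section Green.
Context {G : mgraph R} {p : nat} {g : nat -> nat -> R}.
Hypotheses (mG : is_mgraph G) (pV : p \in verts G) (gG : green G p g).

Lemma dirichlet_green f y : y \in verts G -> dirichlet G f (g y) = f y - f p.
Proof. by move=> yV; apply: dirichlet_dipole => //; case: (gG _ yV). Qed.

Lemma dirichletC f h : dirichlet G f h = dirichlet G h f.
Proof. by apply: eq_bigr => e _; rewrite [X in X / _]mulrC. Qed.

Lemma green_base y : y \in verts G -> g y p = 0.
Proof. by move=> yV; case: (gG _ yV). Qed.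

Lemma green_sym x y : x \in verts G -> y \in verts G -> g x y = g y x.
Proof.
move=> xV yV; have := dirichletC (g x) (g y).
by rewrite !dirichlet_green // !green_base // !subr0.
Qed.

Lemma green_dipole a b : a \in verts G -> b \in verts G ->
  dipole G a b (fun x => g a x - g b x).
Proof.
move=> aV bV x xV; rewrite net_outB.
case: (gG _ aV) => _ ->//; case: (gG _ bV) => _ ->//.
by ring.
Qed.

Definition green_resist g x y : R := g x x + g y y - 2 * g x y.

Lemma resist_green x y : x \in verts G -> y \in verts G -> resist G x y = green_resist g x y.
Proof.
move=> xV yV; rewrite /resist (voltage_dipole _ _ _ _ _ mG _ _ _ (green_dipole x y xV yV)) //.
by rewrite /green_resist (green_sym y x) //; ring.
Qed.
End Green.

(** * Edge deletion: coefficients and y-terms expressed by the Green kernel *)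

Lemma edge_mem G i : (i < size (edges G))%N -> edge G i \in edges G.
Proof. exact: mem_nth. Qed.

Lemma edges_delete G i : (i < size (edges G))%N ->
  perm_eq (edges G) (edge G i :: edges (delete G i)).
Proof.
move=> lti; rewrite -[X in perm_eq X](cat_take_drop i) (drop_nth (0%N, 0%N, 0)) //.
by rewrite -cat1s perm_catCA.
Qed.

Lemma sum_delete G i (F : nat * nat * R -> R) : (i < size (edges G))%N ->
  \sum_(e <- edges G) F e = F (edge G i) + \sum_(e <- edges (delete G i)) F e.
Proof. by move=> lti; rewrite (perm_big _ (edges_delete _ _ lti)) big_cons. Qed.

Lemma delete_sub G i e : (i < size (edges G))%N ->
  e \in edges (delete G i) -> e \in edges G.
Proof. by move=> lti ed; rewrite (perm_mem (edges_delete _ _ lti)) inE ed orbT. Qed.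

Lemma delete_mgraph G i : is_mgraph G -> (i < size (edges G))%N ->
  connected (delete G i) -> is_mgraph (delete G i).
Proof.
case=> uV V0 /allP eV _ lti cD; split=> //.
by apply/allP => e /(delete_sub _ _ _ lti); exact: eV.
Qed.

Lemma adjC G x y : adj G x y = adj G y x.
Proof. by apply: eq_has => e; rewrite orbC. Qed.

Lemma adj_edge G e : e \in edges G -> adj G e.1.1 e.1.2.
Proof. by move=> eG; apply/hasP; exists e => //; rewrite !eqxx. Qed.

Lemma walk_sym G x y : clos_refl_trans nat (fun a b => adj G a b) x y ->
  clos_refl_trans nat (fun a b => adj G a b) y x.
Proof.
elim=> [a b ab|a|a b c _ ba _ cb].
- by apply: rt_step; rewrite adjC.
- exact: rt_refl.
- exact: rt_trans cb ba.
Qed.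

Definition edge_potential g (e : nat * nat * R) x : R := g e.1.1 x - g e.1.2 x.

Section Edge.
Context {G : mgraph R} {p : nat} {g : nat -> nat -> R}.
Hypotheses (mG : is_mgraph G) (pV : p \in verts G) (gG : green G p g).

Lemma edge_potential_dipole e : e \in edges G ->
  dipole G e.1.1 e.1.2 (edge_potential g e).
Proof. by move=> /(edge_ends _ _ mG)[aV bV _]; exact: (green_dipole gG _ _ aV bV). Qed.

Lemma edge_potential_base e : e \in edges G -> edge_potential g e p = 0.
Proof.
move=> /(edge_ends _ _ mG)[aV bV _].
by rewrite /edge_potential !(green_base gG) // subrr.
Qed.

Definition y_term g (e : nat * nat * R) : R :=
  let u := edge_potential g e e.1.1 in let v := edge_potential g e e.1.2 in
  (u ^+ 2 + u * v + v ^+ 2) / e.2.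

Definition foster_term g (e : nat * nat * R) : R :=
  (edge_potential g e e.1.1 - edge_potential g e e.1.2) / e.2.

(** Take L times the indicator of the component of [a] in the graph without the bridge: only the
    bridge has a potential drop, and it carries unit current. *)
Lemma bridge_dipole i : (i < size (edges G))%N -> is_bridge G i ->
  exists h, [/\ dipole G (edge G i).1.1 (edge G i).1.2 h,
    forall x, h x = 0 \/ h x = (edge G i).2,
    h (edge G i).1.1 = (edge G i).2 & h (edge G i).1.2 = 0].
Proof.
move=> lti br; have eG := edge_mem _ _ lti.
have [aV bV L0] := edge_ends _ _ mG eG.
set a := (edge G i).1.1 in aV *; set b := (edge G i).1.2 in bV *.
set L := (edge G i).2 in L0 *.
pose W := clos_refl_trans nat (fun a b => adj (delete G i) a b).
(* A walk from [a] to [b] avoiding the edge could replace every use of it, so the deletion would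
   stay connected. *)
have nWb : ~ W a b.
  move=> Wab; apply: br => x y xV yV.
  have [_ _ _ /(_ x y xV yV)] := mG.
  elim=> [c d /hasP[e]|c|c d d' _ cd _]; last first.
  - exact: rt_trans cd.
  - exact: rt_refl.
  rewrite (perm_mem (edges_delete _ _ lti)) inE => /orP[/eqP->|ed].
    by case/orP=> /andP[/eqP <- /eqP <-] //; apply: walk_sym.
  by move=> ecd; apply: rt_step; apply/hasP; exists e.
pose h x := if excluded_middle_informative (W a x) then L else 0.
have ha : h a = L.
  by rewrite /h; case: excluded_middle_informative => // -[]; apply: rt_refl.
have hb : h b = 0 by rewrite /h; case: excluded_middle_informative.
exists h; split=> //; last first.
  by move=> x; rewrite /h; case: excluded_middle_informative; [right|left].
move=> x xV; rewrite /net_out (sum_delete _ _ _ lti) -/a -/b -/L ha hb.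
rewrite big_seq big1 ?addr0 => [|e ed].
  rewrite ![_ == x]eq_sym; field; exact: lt0r_neq0.
have -> : h e.1.1 = h e.1.2; last by rewrite subrr !mulr0 !mul0r addr0.
have ae := adj_edge _ _ ed.
rewrite /h; do 2 case: excluded_middle_informative => //.
- by move=> nW Wx; case: nW; apply: rt_trans Wx _; apply: rt_step.
- by move=> Wx nW; case: nW; apply: rt_trans Wx _; apply: rt_step; rewrite adjC.
Qed.

(** Parallel connection: keep the potential [h] of unit current in the deleted graph. Putting the
    edge back adds the current R/L from [a] to [b], so the total is (L + R)/L, and rescaling
    restores unit current. *)
Lemma nonbridge_dipole i : (i < size (edges G))%N -> ~ is_bridge G i ->
  let a := (edge G i).1.1 in let b := (edge G i).1.2 in let L := (edge G i).2 in
  exists h, [/\ dipole G a b (fun x => L / (L + Ri G i) * h x),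
    0 <= Ri G i, Ri G i = h a - h b,
    voltage (delete G i) a p b = h a - h p &
    voltage (delete G i) b p a = h p - h b].
Proof.
move=> lti nbr a b L; have eG := edge_mem _ _ lti.
have [aV bV L0] := edge_ends _ _ mG eG; rewrite -/a -/b -/L in aV bV L0.
have mD : is_mgraph (delete G i) by apply: delete_mgraph => //; apply: NNPP.
have [h [hb dh]] := potential_exists (delete G i) a b mD aV bV.
(* Reversing the current negates [h]; the form [0 - h x] fits [net_outB]. *)
have dNh : dipole (delete G i) b a (fun x => 0 - h x).
  move=> x xV; rewrite net_outB dh // /net_out big1 => [|e _];
    last by rewrite !subrr !mulr0 !mul0r addr0.
  by ring.
have RE : Ri G i = h a - h b by apply: voltage_dipole.
have R0 : 0 <= Ri G i.
  rewrite RE -(dirichlet_dipole _ _ _ h h mD aV bV dh).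
  exact: dirichlet_ge0.
exists h; split=> //; last 2 first.
- by rewrite (voltage_dipole _ _ _ _ _ mD bV aV pV dNh); ring.
- by rewrite (voltage_dipole _ _ _ _ _ mD aV bV pV dh).
move=> x xV.
have -> : net_out G (fun x => L / (L + Ri G i) * h x) x = L / (L + Ri G i) * net_out G h x.
  rewrite /net_out mulr_sumr; apply: eq_bigr => e _; ring.
rewrite {1}/net_out (sum_delete _ _ _ lti) -/a -/b -/L -/(net_out (delete G i) h x) dh //.
have LR : L + Ri G i != 0 by rewrite lt0r_neq0 // ltr_wpDr.
rewrite -[h b - h a]opprB -RE ![_ == x]eq_sym; field; by rewrite LR lt0r_neq0.
Qed.

(** By uniqueness the drop of the edge potential is L R/(L + R), or L for a bridge; dividing by L
    gives the coefficient. *)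
Lemma coef_foster_term i : (i < size (edges G))%N -> coef G i = foster_term g (edge G i).
Proof.
move=> lti; have eG := edge_mem _ _ lti; have [aV bV L0] := edge_ends _ _ mG eG.
have dg := edge_potential_dipole _ eG.
rewrite /coef /foster_term; case: excluded_middle_informative => [br|nbr].
  have [h [dh _ ha hb]] := bridge_dipole _ lti br.
  by rewrite (dipole_unique _ _ _ _ _ mG dg dh) // ha hb subr0 divff // lt0r_neq0.
have [h [dh R0 RE _ _]] := nonbridge_dipole _ lti nbr.
rewrite (dipole_unique _ _ _ _ _ mG dg dh) // -mulrBr -RE.
by field; rewrite !lt0r_neq0 // ltr_wpDr.
Qed.

(** With u, v the end values of the edge potential, u^2 + u v + v^2 = ((u - v)^2 + 3 (u + v)^2)/4.
    For c = L/(L + R) one has u - v = c R and u + v = c (Ra - Rb). For a bridge, one of u, v is 0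
    and the other is L or -L. *)
Lemma yterm_y_term i : (i < size (edges G))%N -> yterm G p i = y_term g (edge G i).
Proof.
move=> lti; have eG := edge_mem _ _ lti; have [aV bV L0] := edge_ends _ _ mG eG.
have dg := edge_potential_dipole _ eG.
have fE h x : dipole G (edge G i).1.1 (edge G i).1.2 h -> x \in verts G ->
    edge_potential g (edge G i) x = h x - h p.
  move=> dh xV; rewrite -(dipole_unique _ _ _ _ _ mG dg dh) //.
  by rewrite edge_potential_base // subr0.
rewrite /yterm /y_term /=; case: excluded_middle_informative => [br|nbr].
  have [h [dh hp ha hb]] := bridge_dipole _ lti br.
  rewrite !(fE h) // ha hb.
  by case: (hp p) => ->; field; rewrite lt0r_neq0.
have [h [dh R0 RE -> ->]] := nonbridge_dipole _ lti nbr.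
rewrite !(fE _ _ dh) // -!mulrBr.
have -> : h (edge G i).1.1 = Ri G i + h (edge G i).1.2 by rewrite RE subrK.
by field; rewrite !lt0r_neq0 // ltr_wpDr.
Qed.

Lemma sum_edges (F : nat * nat * R -> R) :
  \sum_(i < size (edges G)) F (edge G i) = \sum_(e <- edges G) F e.
Proof. by rewrite (big_nth (0%N, 0%N, 0)) big_mkord. Qed.

Lemma yinv_y_term : yinv G p = \sum_(e <- edges G) y_term g e.
Proof. by rewrite -sum_edges; apply: eq_bigr => i _; apply: yterm_y_term. Qed.

End Edge.

(** * Contraction of an edge as a metrized graph *)

Definition merge_vertex (e : nat * nat * R) x := if x == e.1.2 then e.1.1 else x.

Definition merge_edge (e e' : nat * nat * R) : nat * nat * R :=
  (merge_vertex e e'.1.1, merge_vertex e e'.1.2, e'.2).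

Lemma merge_vertex1 e : merge_vertex e e.1.1 = e.1.1.
Proof. by rewrite /merge_vertex; case: eqP. Qed.

Lemma merge_vertex2 e : merge_vertex e e.1.2 = e.1.1.
Proof. by rewrite /merge_vertex eqxx. Qed.

Section Contract.
Context {G : mgraph R} {i : nat}.
Hypotheses (mG : is_mgraph G) (lti : (i < size (edges G))%N) (nl : nonloop G i).
Let e := edge G i.
Let eG : e \in edges G := edge_mem G i lti.

Lemma mem_contract x : (x \in verts (contract G i)) = (x != e.1.2) && (x \in verts G).
Proof.
have [aV _ _] := edge_ends _ _ mG eG.
rewrite mem_undup; apply/mapP/andP => [[y yV ->]|[/negPf xb xV]].
  by rewrite -/e; case: (y =P e.1.2) => [_|/eqP yb]; split.
by exists x => //; rewrite -/e xb.
Qed.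

Lemma merge_contract x : x \in verts (contract G i) -> merge_vertex e x = x.
Proof. by rewrite mem_contract /merge_vertex => /andP[/negPf ->]. Qed.

Lemma merge_vertex_in x : x \in verts G -> merge_vertex e x \in verts (contract G i).
Proof.
have [aV _ _] := edge_ends _ _ mG eG.
by rewrite mem_contract /merge_vertex; case: (x =P e.1.2) => [_ _|/eqP -> //]; apply/andP.
Qed.

Lemma sum_contract (F : nat -> R) :
  \sum_(x <- verts (contract G i)) F x = \sum_(x <- verts G) F x - F e.1.2.
Proof.
have [uV _ _ _] := mG; have [_ bV _] := edge_ends _ _ mG eG.
rewrite [in RHS](bigD1_seq e.1.2) //= addrAC subrr add0r -[in RHS]big_filter.
apply: perm_big; apply: uniq_perm; rewrite ?undup_uniq ?filter_uniq // => x.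
by rewrite mem_contract mem_filter.
Qed.

Lemma size_contract : size (verts (contract G i)) = (size (verts G)).-1.
Proof.
have [uV _ _ _] := mG; have [_ bV _] := edge_ends _ _ mG eG.
rewrite -(size_rem bV); apply/perm_size/uniq_perm; rewrite ?undup_uniq ?rem_uniq // => x.
by rewrite mem_contract mem_rem_uniq.
Qed.

(** For connectedness, walks are pushed forward by [merge_vertex]; a step along the contracted edge
    becomes stationary. *)
Lemma contract_mgraph : is_mgraph (contract G i).
Proof.
have [uV V0 /allP eV cG] := mG; have [aV bV L0] := edge_ends _ _ mG eG.
split; first exact: undup_uniq.
- by apply: contraTneq (merge_vertex_in _ aV) => ->.
- apply/allP => _ /mapP[e' /(delete_sub _ _ _ lti) /(edge_ends _ _ mG)[a'V b'V L'0] ->].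
  by rewrite /= !merge_vertex_in.
move=> x y xV yV; rewrite -(merge_contract x xV) -(merge_contract y yV).
move: xV yV; rewrite !mem_contract => /andP[_ xV] /andP[_ yV].
elim: (cG x y xV yV) => [c d /hasP[e']|c|c d d' _ cd _]; last first.
- exact: rt_trans cd.
- exact: rt_refl.
rewrite (perm_mem (edges_delete _ _ lti)) inE => /orP[/eqP-> /orP[]|ed].
- by case/andP=> /eqP <- /eqP <-; rewrite merge_vertex1 merge_vertex2; apply: rt_refl.
- by case/andP=> /eqP <- /eqP <-; rewrite merge_vertex1 merge_vertex2; apply: rt_refl.
move=> ecd; apply: rt_step; apply/hasP.
exists (merge_edge e e'); first by apply/mapP; exists e'.
by rewrite /=; case/orP: ecd => /andP[/eqP <- /eqP <-]; rewrite !eqxx ?orbT.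
Qed.

(** A potential equal at both ends of the edge lives on both graphs; its net current at [x] after
    contraction is its pairing in [G] with the indicator of the preimage of [x]. *)
Lemma net_out_contract h x : h e.1.1 = h e.1.2 ->
  net_out (contract G i) h x = dirichlet G (fun z => (merge_vertex e z == x)%:R) h.
Proof.
move=> hab; have hm z : h (merge_vertex e z) = h z by rewrite /merge_vertex; case: eqP => // ->.
rewrite /dirichlet (sum_delete _ _ _ lti) -/e hab subrr mulr0 mul0r add0r.
rewrite /net_out big_map; apply: eq_bigr => e' _ /=.
rewrite -/(merge_vertex e e'.1.1) -/(merge_vertex e e'.1.2) !hm; ring.
Qed.

End Contract.

(** * The Green kernel of the contraction *)

Definition contract_green g (e : nat * nat * R) y x : R :=
  g y x - edge_potential g e y * edge_potential g e x
          / (edge_potential g e e.1.1 - edge_potential g e e.1.2).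

Section Green.
Context {G : mgraph R} {p : nat} {g : nat -> nat -> R}.
Hypotheses (mG : is_mgraph G) (pV : p \in verts G) (gG : green G p g).

(** The drop is the energy of the edge potential; were it zero, the potential would be constant and
    carry no unit current out of [e.1.1]. *)
Lemma edge_resist_gt0 e : e \in edges G -> e.1.1 != e.1.2 ->
  0 < edge_potential g e e.1.1 - edge_potential g e e.1.2.
Proof.
move=> eG nl; have [aV bV L0] := edge_ends _ _ mG eG.
have dg := edge_potential_dipole mG gG _ eG.
rewrite -(dirichlet_dipole _ _ _ _ _ mG aV bV dg) lt0r dirichlet_ge0 // andbT.
apply/eqP => /(dirichlet0_const _ _ mG) C.
have := dg _ aV; rewrite eqxx (negPf nl) subr0 /net_out big_seq big1 => [/eqP|e' e'G].
  by rewrite eq_sym oner_eq0.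
have [a'V b'V _] := edge_ends _ _ mG e'G.
by rewrite (C _ _ a'V b'V) subrr !mulr0 !mul0r addr0.
Qed.

Lemma edge_potential_loop e x : e.1.1 = e.1.2 -> edge_potential g e x = 0.
Proof. by rewrite /edge_potential => ->; rewrite subrr. Qed.

(** By symmetry of [g], the drop of [g y] across [e] is f_e(y), exactly the drop of the subtracted
    multiple of f_e. *)
Lemma contract_green_ends e y : e \in edges G -> e.1.1 != e.1.2 -> y \in verts G ->
  contract_green g e y e.1.1 = contract_green g e y e.1.2.
Proof.
move=> eG nl yV; have [aV bV L0] := edge_ends _ _ mG eG.
rewrite /contract_green; set r := edge_potential g e e.1.1 - edge_potential g e e.1.2.
have r0 : r != 0 := lt0r_neq0 (edge_resist_gt0 _ eG nl).
have yE : edge_potential g e y = g y e.1.1 - g y e.1.2.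
  by rewrite /edge_potential !(green_sym mG pV gG y).
rewrite yE; apply/eqP; rewrite -subr_eq0; apply/eqP.
have -> : edge_potential g e e.1.1 = r + edge_potential g e e.1.2 by rewrite subrK.
by field.
Qed.

Lemma contract_green_sym e x y : x \in verts G -> y \in verts G ->
  contract_green g e x y = contract_green g e y x.
Proof.
move=> xV yV; rewrite /contract_green (green_sym mG pV gG x) //.
by rewrite [edge_potential g e x * _]mulrC.
Qed.

Lemma contract_green_merge e x y : e \in edges G -> e.1.1 != e.1.2 ->
  x \in verts G -> y \in verts G ->
  contract_green g e (merge_vertex e x) (merge_vertex e y) = contract_green g e x y.
Proof.
move=> eG nl xV yV; have [aV bV L0] := edge_ends _ _ mG eG.
have M z w : w \in verts G -> contract_green g e w (merge_vertex e z) = contract_green g e w z.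
  by move=> wV; rewrite /merge_vertex; case: eqP => // ->; apply: contract_green_ends.
have mxV : merge_vertex e x \in verts G by rewrite /merge_vertex; case: eqP.
by rewrite M // contract_green_sym // M // contract_green_sym.
Qed.

(** [contract_green] projects [g y] onto the energy-orthogonal complement of f_e. Net currents in
    the contraction are pairings in [G] with functions equal at both ends of [e]; these are
    orthogonal to f_e, so the correction leaves the charges unchanged. *)
Lemma green_contract i : (i < size (edges G))%N -> nonloop G i ->
  green (contract G i) (merge_vertex (edge G i) p) (contract_green g (edge G i)).
Proof.
move=> lti nl y yV'; have eG := edge_mem _ _ lti; set e := edge G i in eG *.
have [aV bV L0] := edge_ends _ _ mG eG.
have ymy := merge_contract mG lti nl y yV'; rewrite -/e in ymy.
have yV : y \in verts G by move: yV'; rewrite mem_contract // => /andP[].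
split.
  rewrite -ymy contract_green_merge // /contract_green (green_base gG) //.
  by rewrite (edge_potential_base mG gG) //; ring.
move=> x xV; rewrite net_out_contract //; last exact: contract_green_ends.
set c := edge_potential g e y / (edge_potential g e e.1.1 - edge_potential g e e.1.2).
have E F : dirichlet G F (contract_green g e y) =
    dirichlet G F (g y) - c * dirichlet G F (edge_potential g e).
  rewrite /dirichlet mulr_sumr -sumrB; apply: eq_bigr => e' _.
  by rewrite /contract_green /c; ring.
rewrite E (dirichlet_green mG pV gG) //.
rewrite (dirichlet_dipole _ _ _ _ _ mG aV bV (edge_potential_dipole mG gG _ eG)).
by rewrite merge_vertex1 merge_vertex2 subrr mulr0 subr0 ymy ![x == _]eq_sym.
Qed.

Lemma edge_potential_contract e e' x : e' \in edges G ->
  edge_potential (contract_green g e) e' x =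
  edge_potential g e' x - (edge_potential g e e'.1.1 - edge_potential g e e'.1.2)
     * edge_potential g e x / (edge_potential g e e.1.1 - edge_potential g e e.1.2).
Proof. by move=> e'G; rewrite {1}/edge_potential /contract_green /edge_potential; ring. Qed.

(** The sum may run over all edges of [G]: the contracted edge has zero potential for the new
    kernel, so its term vanishes. *)
Lemma yinv_contract i : (i < size (edges G))%N -> nonloop G i ->
  yinv (contract G i) (merge_vertex (edge G i) p) =
  \sum_(e <- edges G) y_term (contract_green g (edge G i)) e.
Proof.
move=> lti nl; have eG := edge_mem _ _ lti.
have mC := contract_mgraph mG lti nl.
rewrite (yinv_y_term mC (merge_vertex_in mG lti nl p pV) (green_contract _ lti nl)).
rewrite (sum_delete _ _ _ lti) big_map; set e := edge G i in eG *.
have [aV bV L0] := edge_ends _ _ mG eG.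
have -> : y_term (contract_green g e) e = 0.
  have K x : edge_potential (contract_green g e) e x = 0.
    rewrite edge_potential_contract // mulrAC divff ?mul1r ?subrr //.
    exact: lt0r_neq0 (edge_resist_gt0 _ eG nl).
  by rewrite /y_term !K; ring.
rewrite add0r big_seq [RHS]big_seq; apply: eq_bigr => e' /(delete_sub _ _ _ lti).
move=> /(edge_ends _ _ mG)[a'V b'V _].
rewrite -/(merge_vertex e e'.1.1) -/(merge_vertex e e'.1.2) /y_term /edge_potential /=.
by rewrite !contract_green_merge.
Qed.

(** * Foster's identity and the sum of y over contractions *)

Lemma foster : \sum_(e <- edges G) foster_term g e = (size (verts G))%:R - 1.
Proof.
have [uV _ _ _] := mG.
(* The net current of [g x] at [x] is 1, except at the base vertex, where source and sink cancel;
   this gives v - 1. *)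
transitivity (\sum_(x <- verts G) 1 * net_out G (g x) x).
  rewrite sum_net_out //; apply: eq_bigr => e _; rewrite /foster_term /edge_potential.
  by congr (_ / _); ring.
rewrite big_seq; under eq_bigr => x xV.
  have [_ ->] := gG _ xV => //; rewrite eqxx mul1r eq_sym; over.
rewrite -big_seq sumrB big_const_seq count_predT iter_addr_0; congr (_ - _).
by rewrite -[RHS](sum_delta _ _ (fun=> 1) uV pV); apply: eq_bigr => x _; rewrite mulr1.
Qed.

Lemma dirichlet_edge f e : e \in edges G ->
  dirichlet G f (edge_potential g e) = f e.1.1 - f e.1.2.
Proof.
move=> eG; have [aV bV _] := edge_ends _ _ mG eG.
exact: dirichlet_dipole (edge_potential_dipole mG gG _ eG).
Qed.

Lemma edge_potentialE e x : e \in edges G -> x \in verts G ->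
  edge_potential g e x = g x e.1.1 - g x e.1.2.
Proof.
move=> /(edge_ends _ _ mG)[aV bV _] xV.
by rewrite /edge_potential !(green_sym mG pV gG x).
Qed.

Lemma sum_nonloop (F : nat * nat * R -> R) :
  (forall e, e.1.1 = e.1.2 -> F e = 0) ->
  \sum_(i < size (edges G) | nonloop G i) F (edge G i) = \sum_(e <- edges G) F e.
Proof.
move=> F0; rewrite big_mkcond -sum_edges; apply: eq_bigr => i _.
by case: ifPn => // /negPn/eqP /F0.
Qed.

Lemma sum_edge_potential f x : x \in verts G -> f p = 0 ->
  \sum_(e <- edges G) (f e.1.1 - f e.1.2) * edge_potential g e x / e.2 = f x.
Proof.
move=> xV fp; have <- : f x - f p = f x by rewrite fp subr0.
rewrite -(dirichlet_green mG pV gG f x xV).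
by rewrite big_seq [RHS]big_seq; apply: eq_bigr => e eG; rewrite edge_potentialE.
Qed.

Lemma sum_coef_yinv :
  \sum_(i < size (edges G) | nonloop G i)
     coef G i * yinv (contract G i) (merge_vertex (edge G i) p)
  = ((size (verts G))%:R - 2) * yinv G p.
Proof.
rewrite (yinv_y_term mG pV gG).
pose Y := \sum_(e <- edges G) y_term g e.
pose U (e e' : nat * nat * R) : R := edge_potential g e e'.1.1.
pose V (e e' : nat * nat * R) : R := edge_potential g e e'.1.2.
(* [S e e'] is the part of the weighted y-term of [e'] that is linear in the correction from
   contracting [e]. Its first factor is the drop of f_e' across [e], so that a sum over [e] can
   reproduce f_e'. *)
pose S (e e' : nat * nat * R) : R := (U e' e - V e' e) / e.2 / e'.2 *
  ((2 * U e' e' + V e' e') * U e e' + (U e' e' + 2 * V e' e') * V e e').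
pose H e := foster_term g e * Y - \sum_(e' <- edges G) S e e' + y_term g e.
transitivity (\sum_(i < size (edges G) | nonloop G i) H (edge G i)).
  apply: eq_bigr => -[i lti] /= nl; have eG := edge_mem _ _ lti.
  rewrite yinv_contract // (coef_foster_term mG pV gG) //; set e := edge G i in eG *.
  have nl' : e.1.1 != e.1.2 := nl.
  have [aV bV L0] := edge_ends _ _ mG eG.
  have r0 := lt0r_neq0 (edge_resist_gt0 _ eG nl').
  have cubeE := dirichlet_edge (fun x => edge_potential g e x ^+ 3) e eG.
  (* The quartic terms, summed over [e'], form the pairing of f_e^3 with f_e, which is the
     difference of the cubes of the end values. *)
  have YE : y_term g e = (U e e - V e e)^-1 / e.2 *
     dirichlet G (fun x => edge_potential g e x ^+ 3) (edge_potential g e).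
    by rewrite cubeE /y_term /U /V; field; rewrite r0 lt0r_neq0.
  rewrite /H YE /Y /dirichlet !mulr_sumr -sumrB -big_split big_seq [RHS]big_seq.
  apply: eq_bigr => e' e'G /=; have [a'V b'V L'0] := edge_ends _ _ mG e'G.
  (* Reciprocity between edges: both drops are the pairing of f_e with f_e'. *)
  have SE : U e' e - V e' e = U e e' - V e e'.
    by rewrite /U /V -!dirichlet_edge // dirichletC.
  rewrite /S SE /foster_term /y_term !edge_potential_contract // -/(U e e) -/(V e e).
  rewrite -/(U e e') -/(V e e') -/(U e' e') -/(V e' e'); field.
  by rewrite r0 !lt0r_neq0.
rewrite sum_nonloop => [|e ab]; last first.
  rewrite /H /foster_term /y_term !edge_potential_loop // big1 => [|e' _].
    by rewrite !mul0r; ring.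
  by rewrite /S /U /V ab subrr !mul0r.
rewrite /H big_split sumrB /= -mulr_suml foster exchange_big /= -/Y.
(* Summing over [e] reproduces f_e' at its own ends, leaving (2u + v) u + (u + 2v) v = 2 (u^2 + u v
   + v^2). *)
have -> : \sum_(e' <- edges G) \sum_(e <- edges G) S e e' = 2 * Y.
  rewrite /Y mulr_sumr big_seq [RHS]big_seq; apply: eq_bigr => e' e'G.
  have [a'V b'V L'0] := edge_ends _ _ mG e'G; have fp := edge_potential_base mG gG _ e'G.
  transitivity ((2 * U e' e' + V e' e') / e'.2 * U e' e'
      + (U e' e' + 2 * V e' e') / e'.2 * V e' e').
    rewrite {2}/U {3}/V -(sum_edge_potential (edge_potential g e') _ a'V fp).
    rewrite -(sum_edge_potential (edge_potential g e') _ b'V fp).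
    rewrite !mulr_sumr -big_split; apply: eq_bigr => e _ /=.
    by rewrite /S -/(U e' e) -/(V e' e) -/(U e e') -/(V e e'); ring.
  by rewrite /y_term -/(U e' e') -/(V e' e'); ring.
ring.
Qed.
End Green.

(** * The sum of Kirchhoff indices over contractions *)

Section Green.
Context {G : mgraph R} {p : nat} {g : nat -> nat -> R}.
Hypotheses (mG : is_mgraph G) (pV : p \in verts G) (gG : green G p g).

Lemma Kf_green : Kf G = 2^-1 * \sum_(x <- verts G) \sum_(y <- verts G) green_resist g x y.
Proof.
congr (_ * _); rewrite big_seq [RHS]big_seq; apply: eq_bigr => x xV.
rewrite big_seq [RHS]big_seq; apply: eq_bigr => y yV.
exact: (resist_green mG pV gG).
Qed.

Lemma green_resist_contract e x y : x \in verts G -> y \in verts G ->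
  green_resist (contract_green g e) x y =
  green_resist g x y - (edge_potential g e x - edge_potential g e y) ^+ 2
             / (edge_potential g e e.1.1 - edge_potential g e e.1.2).
Proof. by move=> xV yV; rewrite /green_resist /contract_green; ring. Qed.

(** The weight r_e/L cancels the denominator r_e; for a self-loop f_e vanishes and both sides are
    0. *)
Lemma foster_term_resist_contract e x y : e \in edges G -> x \in verts G -> y \in verts G ->
  foster_term g e * green_resist (contract_green g e) x y =
  foster_term g e * green_resist g x y - (edge_potential g e x - edge_potential g e y) ^+ 2 / e.2.
Proof.
move=> eG xV yV; have [aV bV L0] := edge_ends _ _ mG eG.
rewrite green_resist_contract // mulrBr; congr (_ - _); rewrite /foster_term.
have [ab|nl] := eqVneq e.1.1 e.1.2; first by rewrite !edge_potential_loop //; ring.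
by field; rewrite (lt0r_neq0 (edge_resist_gt0 mG gG _ eG nl)) lt0r_neq0.
Qed.

(** By symmetry f_e(x) - f_e(y) is the drop across [e] of [k] = [g x] - [g y], so the sum is the
    energy of [k]. *)
Lemma sum_edge_potential_diff x y : x \in verts G -> y \in verts G ->
  \sum_(e <- edges G) (edge_potential g e x - edge_potential g e y) ^+ 2 / e.2 = green_resist g x y.
Proof.
move=> xV yV; pose k z := g x z - g y z.
have -> : green_resist g x y = k x - k y.
  by rewrite /green_resist /k (green_sym mG pV gG y x) //; ring.
rewrite -(dirichlet_dipole _ _ _ _ _ mG xV yV (green_dipole gG _ _ xV yV)).
rewrite /dirichlet big_seq [RHS]big_seq; apply: eq_bigr => e eG.
by rewrite !(edge_potentialE mG pV gG) // /k; congr (_ / _); ring.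
Qed.

(* If x is the base vertex, the summand on the left plus the y-term of e is
   (Phi(a) (k_a(a) - k_a(b)) + Phi(b) (k_b(b) - k_b(a))) / L, where Phi = r(x, .)
   and k_y = g_y - g_x; the defect D0 for another base vertex sums to 0. *)
Lemma sum_edge_star x : x \in verts G ->
  \sum_(e <- edges G)
    (foster_term g e * ((green_resist g x e.1.1 + green_resist g x e.1.2) / 2)
     - ((edge_potential g e x - edge_potential g e e.1.1) ^+ 2
        + (edge_potential g e x - edge_potential g e e.1.2) ^+ 2) / 2 / e.2)
  = \sum_(y <- verts G) green_resist g x y - yinv G p.
Proof.
move=> xV.
have -> : \sum_(y <- verts G) green_resist g x y =
    \sum_(y <- verts G) green_resist g x y * net_out G (fun z => g y z - g x z) y.
  rewrite big_seq [RHS]big_seq; apply: eq_bigr => y yV.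
  rewrite (green_dipole gG _ _ yV xV) // eqxx; case: eqP => [->|_].
    by rewrite /green_resist; ring.
  by rewrite subr0 mulr1.
rewrite (sum_net_out _ (green_resist g x) (fun y z => g y z - g x z)) //.
have D0 : \sum_(e <- edges G) edge_potential g e x *
    (edge_potential g e e.1.1 + edge_potential g e e.1.2 - edge_potential g e x) / e.2 = 0.
  transitivity (dirichlet G (fun z => g z z - g x z) (g x)).
    rewrite /dirichlet big_seq [RHS]big_seq; apply: eq_bigr => e eG.
    have [aV bV L0] := edge_ends _ _ mG eG.
    rewrite !(edge_potentialE mG pV gG) // (green_sym mG pV gG e.1.2 e.1.1) //.
    by congr (_ / _); ring.
  by rewrite (dirichlet_green mG pV gG) // !(green_base gG) //; ring.
rewrite -[LHS]addr0 -[X in _ + X](mulr0 (- 3)) -[X in _ + - 3 * X]D0.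
rewrite (yinv_y_term mG pV gG) mulr_sumr.
rewrite -sumrB -big_split big_seq [RHS]big_seq; apply: eq_bigr => e eG /=.
have [aV bV L0] := edge_ends _ _ mG eG.
rewrite /foster_term /y_term !(edge_potentialE mG pV gG) // /green_resist.
rewrite (green_sym mG pV gG e.1.2 e.1.1) //.
by field; rewrite lt0r_neq0.
Qed.

(* The Kirchhoff index of the contraction is half the sum over all vertices x, y
   of the old graph minus the sum of r(x, b), as a and b are now one vertex;
   r(x, b) is written as the mean of r(x, a) and r(x, b). *)
Definition foster_Kf (e : nat * nat * R) : R :=
  2^-1 * (\sum_(x <- verts G) \sum_(y <- verts G)
     (foster_term g e * green_resist g x y
      - (edge_potential g e x - edge_potential g e y) ^+ 2 / e.2))
  - \sum_(x <- verts G)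
    (foster_term g e * ((green_resist g x e.1.1 + green_resist g x e.1.2) / 2)
     - ((edge_potential g e x - edge_potential g e e.1.1) ^+ 2
        + (edge_potential g e x - edge_potential g e e.1.2) ^+ 2) / 2 / e.2).

Lemma foster_term_Kf_contract i : (i < size (edges G))%N -> nonloop G i ->
  foster_term g (edge G i) * Kf (contract G i) = foster_Kf (edge G i).
Proof.
move=> lti nl; have eG := edge_mem _ _ lti.
have mC := contract_mgraph mG lti nl.
have gC := green_contract mG pV gG _ lti nl.
have pC := merge_vertex_in mG lti nl p pV.
have -> : Kf (contract G i) = 2^-1 * \sum_(x <- verts (contract G i))
    \sum_(y <- verts (contract G i)) green_resist (contract_green g (edge G i)) x y.
  congr (_ * _); rewrite big_seq [RHS]big_seq; apply: eq_bigr => x xV.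
  rewrite big_seq [RHS]big_seq; apply: eq_bigr => y yV.
  exact: (resist_green mC pC gC).
set e := edge G i in eG *; have [aV bV L0] := edge_ends _ _ mG eG; rewrite /foster_Kf.
rewrite (sum_contract mG lti nl) (sum_contract mG lti nl).
under eq_bigr do rewrite (sum_contract mG lti nl).
rewrite -/e sumrB; set g' := contract_green g e.
have rs x y : x \in verts G -> y \in verts G -> green_resist g' x y = green_resist g' y x.
  by move=> xV yV; rewrite /green_resist /g' (contract_green_sym mG pV gG e x y) //; ring.
have rab x : x \in verts G ->
    green_resist g' x e.1.2 = (green_resist g' x e.1.1 + green_resist g' x e.1.2) / 2.
  move=> xV; suff -> : green_resist g' x e.1.1 = green_resist g' x e.1.2 by field.
  have E y : y \in verts G -> g' y e.1.1 = g' y e.1.2.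
    by move=> yV; exact: (contract_green_ends mG pV gG _ _ eG nl yV).
  rewrite /green_resist -(E x xV) -(E _ bV).
  by rewrite [g' e.1.2 e.1.1](contract_green_sym mG pV gG e) // -/g' -(E _ aV).
have -> : \sum_(y <- verts G) green_resist g' e.1.2 y = \sum_(x <- verts G) green_resist g' x e.1.2.
  by rewrite big_seq [RHS]big_seq; apply: eq_bigr => y yV; apply: rs.
have -> : green_resist g' e.1.2 e.1.2 = 0 by rewrite /green_resist; ring.
(* Here [s] is the full double sum and [t] the sum of the resistances to [b]: dropping [b] from both
   indices removes a row and a column, and the diagonal entry is 0. *)
have -> (s t : R) : foster_term g e * (2^-1 * (s - t - (t - 0))) =
    2^-1 * (foster_term g e * s) - foster_term g e * t.
  by field.
congr (_ * _ - _); rewrite mulr_sumr big_seq [RHS]big_seq; apply: eq_bigr => x xV.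
  rewrite mulr_sumr big_seq [RHS]big_seq; apply: eq_bigr => y yV.
  exact: foster_term_resist_contract.
rewrite rab // mulrA mulrDr !foster_term_resist_contract //; ring.
Qed.

(** The double sums contribute ((v - 1) - 1) Kf by Foster's identity and [sum_edge_potential_diff];
    the star sums subtract 2 Kf - v y. *)
Lemma sum_coef_Kf :
  \sum_(i < size (edges G) | nonloop G i) coef G i * Kf (contract G i)
  = ((size (verts G))%:R - 4) * Kf G + (size (verts G))%:R * yinv G p.
Proof.
transitivity (\sum_(i < size (edges G) | nonloop G i) foster_Kf (edge G i)).
  apply: eq_bigr => -[i lti] /= nl.
  by rewrite (coef_foster_term mG pV gG) // foster_term_Kf_contract.
rewrite sum_nonloop => [|e ab]; last first.
  have r0 : foster_term g e = 0 by rewrite /foster_term !edge_potential_loop //; ring.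
  rewrite /foster_Kf !big1 => [|x _|x _]; first by ring.
    by rewrite r0 !edge_potential_loop //; ring.
  by rewrite big1 // => y _; rewrite r0 !edge_potential_loop //; ring.
have KE := Kf_green; have fE := foster mG pV gG.
rewrite /foster_Kf sumrB -mulr_sumr exchange_big /=.
have -> : \sum_(x <- verts G) \sum_(e <- edges G) \sum_(y <- verts G)
    (foster_term g e * green_resist g x y
     - (edge_potential g e x - edge_potential g e y) ^+ 2 / e.2)
    = ((size (verts G))%:R - 2) * \sum_(x <- verts G) \sum_(y <- verts G) green_resist g x y.
  rewrite mulr_sumr big_seq [RHS]big_seq; apply: eq_bigr => x xV.
  rewrite exchange_big mulr_sumr big_seq [RHS]big_seq; apply: eq_bigr => y yV /=.
  by rewrite sumrB -mulr_suml fE sum_edge_potential_diff //; ring.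
rewrite [X in _ - X]exchange_big /= [X in _ - X]big_seq (eq_bigr _ sum_edge_star).
rewrite -big_seq sumrB big_const_seq count_predT iter_addr_0.
have -> : \sum_(x <- verts G) \sum_(y <- verts G) green_resist g x y = 2 * Kf G by rewrite KE; field.
by rewrite -[_ *+ size _]mulr_natl; field.
Qed.
End Green.

(** * Induction on the number of contractions *)

Definition y_coef (v k : R) : R :=
  (v ^+ 2 - (k + 2) * v + k - 1) * k / ((v - k - 2) * (v - k - 3)).

(** Starting at k = 0 makes the base case trivial. Graph and base vertex stay general, as the
    hypothesis is applied to every contraction with the image of [p]. *)
Lemma Kf_iter_sum k G p : is_mgraph G -> (k + 4 <= size (verts G))%N ->
  p \in verts G ->
  let v := size (verts G) in
  Kf G = ((v - 4 - k)`!%:R / (v - 4)`!%:R) * iter_sum k G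
         - y_coef v%:R k%:R * yinv G p.
Proof.
elim: k G p => [|k IHk] G p mG ltv pV v.
  by rewrite /y_coef subn0 divff ?pnatr_eq0 -?lt0n ?fact_gt0 //=; ring.
have [g gG] := green_exists G p mG pV.
have K1 := sum_coef_Kf mG pV gG; have Y1 := sum_coef_yinv mG pV gG.
(* With v = m + k + 5, truncated subtractions disappear and the coefficient denominators become (m +
   1)(m + 2). *)
pose m := (v - 5 - k)%N; have vE : v = (m + k + 5)%N by rewrite /m; lia.
have F0 n : n`!%:R != 0 :> R by rewrite pnatr_eq0 -lt0n fact_gt0.
have E : \sum_(i < size (edges G) | nonloop G i) coef G i * Kf (contract G i)
    = m`!%:R / (m + k)`!%:R * iter_sum k.+1 G
      - y_coef (v%:R - 1) k%:R * (((size (verts G))%:R - 2) * yinv G p).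
  rewrite -Y1 /= !mulr_sumr -sumrB; apply: eq_bigr => -[i lti] /= nl.
  have mC := contract_mgraph mG lti nl; have sC := size_contract mG lti nl.
  rewrite (IHk _ _ mC _ (merge_vertex_in mG lti nl p pV)) sC -/v; last by lia.
  have -> : (v.-1 - 4 - k = m)%N by lia.
  have -> : (v.-1 - 4 = m + k)%N by lia.
  have -> : v.-1%:R = v%:R - 1 :> R by rewrite vE addnS natrD /= mulrS; ring.
  ring.
rewrite K1 -/v in E.
have -> : (v - 4 - k.+1 = m)%N by lia.
have -> : (v - 4 = (m + k).+1)%N by lia.
have v4 : v%:R - 4 = (m + k).+1%:R :> R by rewrite vE -[(m + k).+1]addn1 !natrD; ring.
have K0 : (m + k).+1%:R != 0 :> R by rewrite pnatr_eq0.
apply: (mulfI K0); rewrite -[in LHS]v4.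
move: E => /(congr1 (fun z => z - v%:R * yinv G p)); rewrite addrK => ->.
rewrite factS natrM /y_coef.
have m1 : (m%:R + 1 : R) != 0 by rewrite -(natrD _ m 1) addn1 pnatr_eq0.
have m2 : (m%:R + 2 : R) != 0 by rewrite -(natrD _ m 2) addn2 pnatr_eq0.
have vR : v%:R = m%:R + k%:R + 5 :> R by rewrite vE !natrD.
have kR : k.+1%:R = k%:R + 1 :> R by rewrite -addn1 natrD.
have mkR : (m + k).+1%:R = m%:R + k%:R + 1 :> R by rewrite -addn1 !natrD.
(* What remains for y is the recursion (v - 4) c(v, k + 1) = (v - 2) c(v - 1, k) + v, with c =
   [y_coef]. *)
rewrite mkR in K0 *; rewrite vR kR; field.
have -> : m%:R + k%:R + 5 - (k%:R + 1) - 3 = m%:R + 1 :> R by ring.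
have -> : m%:R + k%:R + 5 - (k%:R + 1) - 2 = m%:R + 2 :> R by ring.
by rewrite K0 m1 m2 F0.
Qed.
End Networks.

Theorem theorem3p12 (R : realFieldType) (G : mgraph R) (p : nat) :
  is_mgraph G -> (5 <= size (verts G))%N -> p \in verts G ->
  let v := size (verts G) in
  (forall k : nat, (1 <= k <= v - 4)%N ->
     Kf G = ((v - 4 - k)`!%:R / (v - 4)`!%:R) * iter_sum k G
            - ((v%:R ^+ 2 - (k + 2)%:R * v%:R + k%:R - 1) * k%:R
               / ((v - k - 2)%:R * (v - k - 3)%:R)) * yinv G p)
  /\
  Kf G = (1 / (v - 4)`!%:R) * iter_sum (v - 4) G
         - ((3 * v - 5)%:R * (v - 4)%:R / 2) * yinv G p.
Proof.
move=> mG v5 pV v.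
have main k : (k <= v - 4)%N ->
     Kf G = ((v - 4 - k)`!%:R / (v - 4)`!%:R) * iter_sum k G
            - ((v%:R ^+ 2 - (k + 2)%:R * v%:R + k%:R - 1) * k%:R
               / ((v - k - 2)%:R * (v - k - 3)%:R)) * yinv G p.
  move=> kv; rewrite [LHS](Kf_iter_sum k G p) //; last by lia.
  by rewrite /y_coef !natrB ?natrD //; lia.
split=> [k /andP[_ kv]|]; first exact: main.
rewrite [LHS](main (v - 4)%N) // subnn fact0; congr (_ - _ * _).
(* At k = v - 4 the denominators are 2 and 1, and the numerator factor v^2 - (v - 2) v + v - 5 is 3v
   - 5. *)
have [m vE] : exists m, v = (m + 5)%N by exists (v - 5)%N; lia.
have -> : (v - (v - 4) - 2 = 2)%N by lia.
have -> : (v - (v - 4) - 3 = 1)%N by lia.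
have -> : (v - 4 = m + 1)%N by lia.
have -> : (3 * v - 5 = 3 * m + 10)%N by lia.
by rewrite vE (natrD _ (3 * m)) natrM !natrD; field.
Qed.
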